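(* Let $k,n\in\mathbb{N}$ with $k\ge 1$ and let $w\in\{0,1\}^{\mathbb{N}}$ be an infinite sequence such that for every $j$ with $0\le j\le k$, the word $w_{[j,j+n)}$ is colourable if and only if $j\in\{0,k\}$. Then $\psi(w_{[0,n)})\neq\psi(w_{[k,k+n)})$.
   Context: For a (finite or infinite) sequence $w=w_0w_1\dots$ over $\{0,1\}$, $w_{[a,b)}=w_a\dots w_{b-1}$. For a finite string $w$ over $\{0,1\}$, $\#w$ is its length, $\varepsilon$ the empty string; for $\#w\ge1$, $l(w)$ is $w$ without its last letter and $r(w)$ is $w$ without its first letter. $T^n$ is the alternating string of length $n$ starting with $0$ ($T^0=\varepsilon$, $T^n=T^{n-1}0$ for odd $n$, $T^n=T^{n-1}1$ for even $n\ge2$) and $CT^n$ its letterwise complement. $\xi$: $\xi(\varepsilon)=0$; $\xi(w)=1$ if $w=T^k$, $k\ge2$ even; $\xi(w)=-1$ if $w=CT^k$, $k\ge2$ even; otherwise $\xi(w)=\operatorname{sgn}(\xi(l(w))+\xi(r(w)))$. $\phi$: $\phi(\varepsilon)=0$; $\phi(w)=-1$ if $w=0^k$, $k$ odd; $\phi(w)=1$ if $w=1^k$, $k$ odd; otherwise $\phi(w)=\operatorname{sgn}(\phi(r(w))-\phi(l(w)))$. $\psi(w)=\xi(w)^{\#w}\phi(w)$ (with $0^0=1$); $w$ is colourable iff $\psi(w)\ne0$. *)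

(* Defs.v *)
From HB Require Import structures.
From mathcomp Require Import all_boot all_order all_algebra.

Set Implicit Arguments.
Unset Strict Implicit.
Unset Printing Implicit Defensive.

Import Order.TTheory GRing.Theory Num.Theory.
Local Open Scope ring_scope.

(* The letters 0 and 1 are false and true. *)
Definition word := seq bool.

(* The factor w_a ... w_(b-1). *)
Definition factor (w : nat -> bool) (a b : nat) : word :=
  [seq w i | i <- iota a (b - a)].

Definition lw (w : word) : word := take (size w).-1 w.
Definition rw (w : word) : word := behead w.

Fixpoint T (n : nat) : word :=
  if n is m.+1 then rcons (T m) (~~ odd n) else [::].
Definition CT (n : nat) : word := map negb (T n).

(* The recursion on l(w) and r(w) is run with the length of w as fuel; xi_nil,
   xi_T, xi_CT, xi_step and phi_nil, phi_0, phi_1, phi_step below are the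
   defining equations. *)
Fixpoint xi_rec (fuel : nat) (w : word) : int :=
  if fuel is m.+1 then
    let k := size w in
    if [&& w == T k, (2 <= k)%N & ~~ odd k] then 1
    else if [&& w == CT k, (2 <= k)%N & ~~ odd k] then -1
    else Num.sg (xi_rec m (lw w) + xi_rec m (rw w))
  else 0.
Definition xi (w : word) : int := xi_rec (size w) w.

Fixpoint phi_rec (fuel : nat) (w : word) : int :=
  if fuel is m.+1 then
    let k := size w in
    if (w == nseq k false) && odd k then -1
    else if (w == nseq k true) && odd k then 1
    else Num.sg (phi_rec m (rw w) - phi_rec m (lw w))
  else 0.
Definition phi (w : word) : int := phi_rec (size w) w.

Definition psi (w : word) : int := xi w ^+ size w * phi w.

Definition colourable (w : word) : Prop := psi w <> 0.

Lemma lw_rcons (w : word) (a : bool) : lw (rcons w a) = w.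
Proof. by rewrite /lw size_rcons /= -cats1 take_size_cat. Qed.

Lemma size_lw (w : word) : size (lw w) = (size w).-1.
Proof. by rewrite size_take; case: w => //= a s; rewrite ltnSn. Qed.

Lemma size_rw (w : word) : size (rw w) = (size w).-1.
Proof. exact: size_behead. Qed.

Lemma size_T (n : nat) : size (T n) = n.
Proof. by elim: n => //= n IHn; rewrite size_rcons IHn. Qed.

Lemma size_CT (n : nat) : size (CT n) = n.
Proof. by rewrite size_map size_T. Qed.

Lemma T_head (n : nat) : (0 < n)%N -> head true (T n) = false.
Proof.
case: n => // n _; elim: n => // n IHn.
have -> : T n.+2 = rcons (T n.+1) (~~ odd n.+2) by [].
by move: IHn (size_T n.+1); case: (T n.+1).
Qed.

Lemma CT_neq_T (n : nat) : (0 < n)%N -> CT n <> T n.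
Proof.
move=> n_gt0; rewrite /CT; move: (T_head n_gt0) (size_T n).
case: (T n) => [|a s] /=; first by move=> _ e; rewrite -e in n_gt0.
by move=> -> _ [].
Qed.

Lemma xi_nil : xi [::] = 0.
Proof. by []. Qed.

Lemma xi_T (k : nat) : (2 <= k)%N -> ~~ odd k -> xi (T k) = 1.
Proof.
move=> k2 ek; rewrite /xi size_T; case: k k2 ek => // k k2 ek.
by rewrite [LHS]/= -/(T k.+1) size_T eqxx k2 ek.
Qed.

Lemma xi_CT (k : nat) : (2 <= k)%N -> ~~ odd k -> xi (CT k) = -1.
Proof.
move=> k2 ek; rewrite /xi size_CT; case: k k2 ek => // k k2 ek.
rewrite /xi_rec -/xi_rec size_CT eqxx k2 ek; case: eqP => // e.
by case: (@CT_neq_T k.+1).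
Qed.

Lemma xi_step (w : word) :
  (0 < size w)%N ->
  (forall k : nat, (2 <= k)%N -> ~~ odd k -> w <> T k) ->
  (forall k : nat, (2 <= k)%N -> ~~ odd k -> w <> CT k) ->
  xi w = Num.sg (xi (lw w) + xi (rw w)).
Proof.
rewrite /xi size_lw size_rw; case e: (size w) => [|n] // _ nT nCT.
rewrite /xi_rec -/xi_rec e [n.+1.-1]/=.
case: and3P => [[/eqP wT k2 ek]|_]; first by case: (nT _ k2 ek).
by case: and3P => [[/eqP wT k2 ek]|_]; first by case: (nCT _ k2 ek).
Qed.

Lemma phi_nil : phi [::] = 0.
Proof. by []. Qed.

Lemma phi_0 (k : nat) : odd k -> phi (nseq k false) = -1.
Proof.
move=> ok; rewrite /phi size_nseq; case: k ok => // k ok.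
by rewrite /phi_rec -/phi_rec size_nseq eqxx ok.
Qed.

Lemma phi_1 (k : nat) : odd k -> phi (nseq k true) = 1.
Proof.
move=> ok; rewrite /phi size_nseq; case: k ok => // k ok.
by rewrite /phi_rec -/phi_rec size_nseq eqxx ok andbT.
Qed.

Lemma phi_step (w : word) :
  (0 < size w)%N ->
  (forall k : nat, odd k -> w <> nseq k false) ->
  (forall k : nat, odd k -> w <> nseq k true) ->
  phi w = Num.sg (phi (rw w) - phi (lw w)).
Proof.
rewrite /phi size_lw size_rw; case e: (size w) => [|n] // _ n0 n1.
rewrite /phi_rec -/phi_rec e [n.+1.-1]/=.
case: andP => [[/eqP w0 ok]|_]; first by case: (n0 _ ok).
by case: andP => [[/eqP w1 ok]|_]; first by case: (n1 _ ok).
Qed.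

(* Main.v *)
Require Import Defs.
From mathcomp Require Import all_boot all_order all_algebra.
From mathcomp Require Import zify.

(** Fix the sequence w and write xi_m(i), phi_m(i) for the values on the factor
    of length m at position i.  Induction on odd m shows: phi_m never vanishes;
    xi_(m+1) and phi_(m+1) vanish at the same positions; xi_(m+1) changes sign
    across every gap of zeros; two adjacent zeros of xi_(m+1) come from a
    constant factor, and three adjacent nonzero values of alternating sign from
    an alternating one.  The last two facts say that the exceptional clauses in
    the definitions of xi and phi apply exactly where needed.

    For even n, psi_n = phi_n records the sign changes of the nowhere zero
    sequence phi_(n-1), so its nonzero values alternate.  For odd n,
    psi_n(i) = sgn (a_i + a_(i+1)) sgn (b_(i+1) - b_i) with a = xi_(n-1) and
    b = phi_(n-1); the nonzero values of b alternate and a changes sign across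
    gaps, which forces the nonzero values of psi_n to alternate too. *)
Import GRing.Theory.
Local Open Scope ring_scope.

(** * Values of [xi] and [phi] on the factors of a sequence *)

Definition xiw (w : nat -> bool) (m i : nat) : int := xi (factor w i (i + m)).
Definition phiw (w : nat -> bool) (m i : nat) : int := phi (factor w i (i + m)).

Definition constant_on (w : nat -> bool) (i m : nat) : Prop :=
  forall t, (t < m)%N -> w (i + t)%N = w i.
Definition alternating_on (w : nat -> bool) (i m : nat) : Prop :=
  forall t, (t < m)%N -> w (i + t)%N = w i (+) odd t.

Definition letter_sign (b : bool) : int := if b then 1 else -1.

Lemma factorE w i m : factor w i (i + m) = [seq w j | j <- iota i m].
Proof. by rewrite /factor addKn. Qed.

Lemma size_factor w i m : size (factor w i (i + m)) = m.
Proof. by rewrite factorE size_map size_iota. Qed.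

Lemma nth_factor w i m t :
  (t < m)%N -> nth false (factor w i (i + m)) t = w (i + t)%N.
Proof.
by move=> tm; rewrite factorE (nth_map 0%N) ?size_iota// nth_iota.
Qed.

Lemma lw_factor w i m : lw (factor w i (i + m.+1)) = factor w i (i + m).
Proof. by rewrite !factorE -addn1 iotaD map_cat cats1 lw_rcons. Qed.

Lemma rw_factor w i m : rw (factor w i (i + m.+1)) = factor w i.+1 (i.+1 + m).
Proof. by rewrite !factorE. Qed.

Lemma nth_T n t : (t < n)%N -> nth false (T n) t = odd t.
Proof.
elim: n => // n IHn; rewrite ltnS => tn.
rewrite /= nth_rcons size_T; case: ltnP => [|nt]; first exact: IHn.
have -> : t = n by lia.
by rewrite eqxx negbK.
Qed.

Lemma nth_CT n t : (t < n)%N -> nth false (CT n) t = ~~ odd t.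
Proof. by move=> tn; rewrite (nth_map false) ?size_T// nth_T. Qed.

Lemma factor_eqP w i m (s : word) : size s = m ->
  reflect (forall t, (t < m)%N -> w (i + t)%N = nth false s t)
          (factor w i (i + m) == s).
Proof.
move=> sm; apply: (iffP eqP) => [<- t tm|ws]; first by rewrite nth_factor.
apply: (@eq_from_nth _ false); rewrite size_factor// => t tm.
by rewrite nth_factor// ws.
Qed.

Lemma alternatingP w i m :
  reflect (alternating_on w i m)
          (factor w i (i + m) == if w i then CT m else T m).
Proof.
apply: (iffP (factor_eqP _ _ _ _ _)) => [|wm t tm|wm t tm].
- by case: (w i); rewrite ?size_CT ?size_T.
- by rewrite wm//; case: (w i); rewrite ?nth_CT ?nth_T.
- by rewrite wm//; case: (w i); rewrite ?nth_CT ?nth_T.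
Qed.

Lemma constantP w i m :
  reflect (constant_on w i m) (factor w i (i + m) == nseq m (w i)).
Proof.
apply: (iffP (factor_eqP _ _ _ _ _)) => [|wm t tm|wm t tm].
- by rewrite size_nseq.
- by rewrite wm// nth_nseq tm.
- by rewrite wm// nth_nseq tm.
Qed.

Lemma alternating_cat w i m : (1 < m)%N ->
  alternating_on w i m -> alternating_on w i.+1 m -> alternating_on w i m.+1.
Proof.
move=> m1 wi wSi [|t] tm; first by rewrite addn0 addbF.
have := wSi t tm; rewrite addSnnS => ->.
by have := wi 1%N m1; rewrite addn1 /= => ->; rewrite addbT addNb addbN.
Qed.

Lemma constant_cat w i m : (1 < m)%N ->
  constant_on w i m -> constant_on w i.+1 m -> constant_on w i m.+1.
Proof.
move=> m1 wi wSi [|t] tm; first by rewrite addn0.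
by have := wSi t tm; rewrite addSnnS => ->; rewrite -addn1; apply: wi.
Qed.

Lemma constant_init w i m : constant_on w i m.+1 -> constant_on w i m.
Proof. by move=> wC t tm; apply: wC; lia. Qed.

Lemma constant_succ w i m : constant_on w i m.+2 -> w i.+1 = w i.
Proof. by move=> /(_ 1%N isT); rewrite addn1. Qed.

Lemma constant_tail w i m : constant_on w i m.+1 -> constant_on w i.+1 m.
Proof.
move=> wC t; case: m wC => // m wC tm.
by rewrite addSnnS (constant_succ _ _ _ wC) wC.
Qed.

Lemma xi_bound s : -1 <= xi s <= 1.
Proof.
rewrite /xi; case: (size s) => //= n.
by do 2 case: ifP => // _; lia.
Qed.

Lemma phi_bound s : -1 <= phi s <= 1.
Proof.
rewrite /phi; case: (size s) => //= n.
by do 2 case: ifP => // _; lia.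
Qed.

Lemma xiw_bound w m i : -1 <= xiw w m i <= 1.
Proof. exact: xi_bound. Qed.

Lemma phiw_bound w m i : -1 <= phiw w m i <= 1.
Proof. exact: phi_bound. Qed.

Lemma xiw_alternating w i m : (0 < m)%N -> ~~ odd m -> alternating_on w i m ->
  xiw w m i = - letter_sign (w i).
Proof.
move=> m0 me /alternatingP/eqP wA; rewrite /xiw wA.
have m2 : (2 <= m)%N by lia.
by case: (w i); rewrite ?xi_CT ?xi_T.
Qed.

Lemma xiw_step w i m : odd m.+1 \/ ~ alternating_on w i m.+1 ->
  xiw w m.+1 i = Num.sg (xiw w m i + xiw w m i.+1).
Proof.
move=> H; rewrite /xiw xi_step ?size_factor// ?lw_factor ?rw_factor//.
- move=> k k2 ke E; have mk : k = m.+1 by rewrite -(size_T k) -E size_factor.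
  subst k; case: H => [|[]]; first by rewrite (negbTE ke).
  apply/alternatingP; rewrite -[in w i](addn0 i).
  by rewrite -(@nth_factor w i m.+1)// E nth_T.
- move=> k k2 ke E; have mk : k = m.+1 by rewrite -(size_CT k) -E size_factor.
  subst k; case: H => [|[]]; first by rewrite (negbTE ke).
  apply/alternatingP; rewrite -[in w i](addn0 i).
  by rewrite -(@nth_factor w i m.+1)// E nth_CT.
Qed.

(** * Constant and nearly constant factors *)

Lemma xiw_constant w i m : constant_on w i m -> xiw w m i = 0.
Proof.
elim: m i => [|m IHm] i wC; first by rewrite /xiw factorE.
rewrite xiw_step.
  by rewrite (IHm i) ?(IHm i.+1)//; [apply: constant_tail|apply: constant_init].
(* A single letter is also alternating, so there the odd length has to exclude the exceptional
   clause. *)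
case: m wC {IHm} => [|m] wC; [by left|right].
by move=> /(_ 1%N isT); rewrite wC//=; case: (w i).
Qed.

Lemma phiw_constant w i m : odd m -> constant_on w i m ->
  phiw w m i = letter_sign (w i).
Proof.
move=> mo /constantP/eqP wC; rewrite /phiw wC.
by case: (w i); rewrite ?phi_0 ?phi_1.
Qed.

Lemma phiw_step w i m : ~~ odd m.+1 \/ ~ constant_on w i m.+1 ->
  phiw w m.+1 i = Num.sg (phiw w m i.+1 - phiw w m i).
Proof.
have main k b : odd k -> ~~ odd m.+1 \/ ~ constant_on w i m.+1 ->
    factor w i (i + m.+1) <> nseq k b.
  move=> ko H E; have mk : k = m.+1 by rewrite -(size_nseq k b) -E size_factor.
  subst k; case: H => [|[]]; first by rewrite ko.
  apply/constantP; rewrite -[in w i](addn0 i).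
  by rewrite -(@nth_factor w i m.+1)// E.
move=> H; rewrite /phiw phi_step ?size_factor// ?lw_factor ?rw_factor//.
  by move=> k ko; apply: main.
by move=> k ko; apply: main.
Qed.

Lemma phiw_constant_even w i m : ~~ odd m -> constant_on w i m ->
  phiw w m i = 0.
Proof.
case: m => [|m] me wC; first by rewrite /phiw factorE.
rewrite phiw_step; last by left.
rewrite !phiw_constant; try by [lia|apply: constant_init|apply: constant_tail].
by case: m me wC => // m _ /constant_succ ->; rewrite subrr.
Qed.

(** Dropping the first letter keeps the shape. Dropping the last leaves a constant word, whose [phi]
    is 0 or [letter_sign (w i)] by parity, so the sign of the difference stays that of the tail. *)
Lemma phiw_last_differs w i k : constant_on w i k.+1 ->
  w (i + k.+1)%N = ~~ w i -> phiw w k.+2 i = - letter_sign (w i).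
Proof.
elim: k i => [|k IHk] i wC wl.
  rewrite phiw_step; last by left.
  rewrite !phiw_constant//; first by rewrite -addn1 wl; case: (w i).
  by case=> // _; rewrite addn0.
have wi : w i.+1 = w i by rewrite -addn1 wC.
rewrite phiw_step; last first.
  by right=> /(_ k.+2 (ltnSn _)); rewrite wl; case: (w i).
rewrite IHk; last by rewrite addSnnS wl wi.
  case: (boolP (odd k)) => ko; last first.
    by rewrite phiw_constant_even//= ?negbK// wi; case: (w i).
  by rewrite phiw_constant//= ?negbK// wi; case: (w i).
by move=> t tm; rewrite addSnnS wi wC.
Qed.

(** Here the factor of the same shape is the one without its last letter. Its [phi] enters with a
    minus sign, so the sign flips with each added letter. *)
Lemma phiw_head_differs w i k : constant_on w i.+1 k.+1 -> w i = ~~ w i.+1 ->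
  phiw w k.+2 i = letter_sign (w i.+1) * (-1) ^+ k.
Proof.
elim: k => [|k IHk] wC wi.
  rewrite phiw_step; last by left.
  rewrite !phiw_constant//; first by rewrite wi; case: (w i.+1).
  by case=> // _; rewrite addn0.
rewrite phiw_step; last first.
  by right=> /constant_succ E; move: wi; rewrite E; case: (w i).
rewrite IHk//; last exact: constant_init.
rewrite exprS -signr_odd.
case: (boolP (odd k)) => ko; last first.
  by rewrite phiw_constant_even//=; [case: (w i.+1)|rewrite negbK].
by rewrite phiw_constant//=; [case: (w i.+1)|rewrite negbK].
Qed.

(** * Sign alternation across zeros *)

(** With [g = 0] all consecutive nonzero values alternate. With [g = 1] adjacent nonzero values are
    unconstrained and only gaps of at least one zero force a sign change. *)
Definition alternates_beyond (g : nat) (u : nat -> int) : Prop :=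
  forall i d, (g <= d)%N -> u i <> 0 ->
    (forall t, (t < d)%N -> u (i + t.+1)%N = 0) ->
    u (i + d.+1)%N <> 0 -> u (i + d.+1)%N = - u i.

(** A nonzero [v i] marks a flip of [u] to the sign [v i]; [u] then keeps that sign until the next
    flip, which has to go the other way. *)
Lemma alternates_sgdiff (u v : nat -> int) :
  (forall i, -1 <= u i <= 1) -> (forall i, u i <> 0) ->
  (forall i, v i = Num.sg (u i.+1 - u i)) -> alternates_beyond 0 v.
Proof.
move=> ub u0 vE i d _ vi vt vd.
have uS t : (t <= d)%N -> u (i + t.+1)%N = u i.+1.
  elim: t => [|t IHt] td; first by rewrite addn1.
  have := vt t td; have := IHt (ltnW td); rewrite vE !addnS.
  lia.
have := uS d (leqnn d); move: vi vd; rewrite !vE addnS.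
move: (ub i) (ub i.+1) (ub (i + d).+2) (u0 i) (u0 i.+1) (u0 (i + d).+2).
lia.
Qed.

(** * The invariant and its base case *)

Record invariant (w : nat -> bool) (m : nat) : Prop := Invariant {
  phiw_neq0 : forall i, phiw w m i <> 0;
  xiw_phiw : forall i, xiw w m.+1 i = 0 <-> phiw w m.+1 i = 0;
  xiw_gap : alternates_beyond 1 (xiw w m.+1);
  xiw_00 : forall i, xiw w m.+1 i = 0 -> xiw w m.+1 i.+1 = 0 ->
    constant_on w i m.+2;
  xiw_alt3 : forall i, xiw w m.+1 i <> 0 -> xiw w m.+1 i.+1 = - xiw w m.+1 i ->
    xiw w m.+1 i.+2 = xiw w m.+1 i -> alternating_on w i m.+3 }.

Lemma phiw_alternates w m : odd m -> (forall i, phiw w m i <> 0) ->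
  alternates_beyond 0 (phiw w m.+1).
Proof.
move=> mo m0; apply: (@alternates_sgdiff (phiw w m)) => // i.
  exact: phiw_bound.
by rewrite phiw_step//; left; rewrite /= negbK.
Qed.

Lemma alternates_next {u} i : alternates_beyond 0 u ->
  u i <> 0 -> u i.+1 <> 0 -> u i.+1 = - u i.
Proof. by move=> /(_ i 0%N isT); rewrite addn1 => H u0 u1; apply: H. Qed.

Lemma alternates_next2 {g u} i : (g <= 1)%N -> alternates_beyond g u ->
  u i <> 0 -> u i.+1 = 0 -> u i.+2 <> 0 -> u i.+2 = - u i.
Proof.
move=> g1 /(_ i 1%N g1); rewrite addn2 => H u0 u1 u2; apply: H => //.
by case=> // _; rewrite addn1.
Qed.

Lemma xiw_2 w i :
  xiw w 2 i = if w i == w i.+1 then 0 else letter_sign (w i.+1).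
Proof. by rewrite /xiw factorE /=; case: (w i); case: (w i.+1). Qed.

Lemma phiw_2 w i :
  phiw w 2 i = if w i == w i.+1 then 0 else letter_sign (w i.+1).
Proof. by rewrite /phiw factorE /=; case: (w i); case: (w i.+1). Qed.

Lemma invariant1 w : invariant w 1.
Proof.
have phi0 i : phiw w 1 i <> 0.
  by rewrite /phiw factorE /=; case: (w i).
split=> // [i|i d _ ui ut ud|i|i].
- by rewrite xiw_2 phiw_2.
- have E j : xiw w 2 j = phiw w 2 j by rewrite xiw_2 phiw_2.
  rewrite !E in ui ud *; apply: (@phiw_alternates w 1 isT phi0) => // t td.
  by rewrite -E ut.
- rewrite !xiw_2 => w0 w1 [|[|[|t]]]//.
  + by rewrite addn0.
  + by rewrite addn1; move: w0; case: (w i); case: (w i.+1).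
  + by rewrite addn2; move: w0 w1; case: (w i); case: (w i.+1); case: (w i.+2).
- rewrite !xiw_2 => w0 w1 w2 [|[|[|[|t]]]]//=;
    rewrite ?addn0 ?addn1 ?addn2 ?addn3;
    move: w0 w1 w2; case: (w i); case: (w i.+1); case: (w i.+2) => //;
    by case: (w i.+3).
Qed.

(* The coefficients 2, 3, 2 only encode a rule on triples of signs: the middle
   sign wins, unless both neighbours oppose it, and a middle 0 leaves the
   decision to its neighbours. *)
Lemma xiw_step2 w m i : odd m -> invariant w m ->
  xiw w m.+3 i =
  Num.sg (2 * xiw w m.+1 i + 3 * xiw w m.+1 i.+1 + 2 * xiw w m.+1 i.+2).
Proof.
move=> mo [_ _ _ _ alt3].
case: (alternatingP w i m.+3) => [wA|wA].
  have wi : w i.+1 = ~~ w i by have := wA 1%N isT; rewrite addn1 addbT.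
  have wi2 : w i.+2 = w i by have := wA 2%N isT; rewrite addn2 addbF.
  rewrite !xiw_alternating//=; try lia.
  - by rewrite wi wi2; case: (w i).
  - by move=> t tm; rewrite addSnnS addSnnS wA ?wi2//= ?negbK//; lia.
  - by move=> t tm; rewrite addSnnS wA ?wi//= ?addbN ?addNb//; lia.
  - by move=> t tm; rewrite wA//; lia.
rewrite xiw_step; last by right.
rewrite !(@xiw_step w _ m.+1) /= ?negbK; try by left.
(* On such a triple two ordinary steps would give 0, whereas the rule gives the outer sign. *)
have alt3i : ~ (xiw w m.+1 i <> 0 /\ xiw w m.+1 i.+1 = - xiw w m.+1 i /\
    xiw w m.+1 i.+2 = xiw w m.+1 i).
  by case=> x0 [xy xz]; apply: wA; apply: alt3.
move: (xiw_bound w m.+1 i) (xiw_bound w m.+1 i.+1) (xiw_bound w m.+1 i.+2).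
lia.
Qed.

(** * The induction step from [m] to [m.+2] *)

Lemma phiw_odd_step w m i :
  xiw w m.+1 i <> 0 \/ xiw w m.+1 i.+1 <> 0 ->
  phiw w m.+2 i = Num.sg (phiw w m.+1 i.+1 - phiw w m.+1 i).
Proof.
move=> xi0; rewrite phiw_step//; right=> wC.
by case: xi0; apply; apply: xiw_constant;
  [apply: constant_init|apply: constant_tail].
Qed.

(** Adjacent nonzero values of [phiw w m.+1] are opposite, so two adjacent values agree only if both
    are 0; then the factor is constant of odd length. *)
Lemma invariant_phiw_neq0 w m i : odd m -> invariant w m ->
  phiw w m.+2 i <> 0.
Proof.
move=> mo I; have balt := phiw_alternates _ _ mo (phiw_neq0 _ _ I).
have [x0|x0] := eqVneq (xiw w m.+1 i) 0; last first.
  rewrite phiw_odd_step//; last by left; apply/eqP.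
  have := alternates_next i balt; have := (xiw_phiw _ _ I i).
  lia.
have [y0|y0] := eqVneq (xiw w m.+1 i.+1) 0; last first.
  rewrite phiw_odd_step//; last by right; apply/eqP.
  have := (xiw_phiw _ _ I i); have := (xiw_phiw _ _ I i.+1).
  lia.
rewrite phiw_constant//=; first by case: (w i).
  by rewrite negbK.
exact: (xiw_00 _ _ I).
Qed.

(** Split on the middle of the three values of [xiw w m.+1]. If it is nonzero, so are both sides. If
    it is 0, both sides vanish exactly when the outer values are both 0 or both nonzero, hence
    opposite. *)
Lemma invariant_xiw_phiw w m i : odd m -> invariant w m ->
  xiw w m.+3 i = 0 <-> phiw w m.+3 i = 0.
Proof.
move=> mo I; have balt := phiw_alternates _ _ mo (phiw_neq0 _ _ I).
have [[oo gap] w00] := (xiw_phiw _ _ I, xiw_gap _ _ I, xiw_00 _ _ I).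
rewrite xiw_step2// phiw_step; last by left; rewrite /= !negbK.
have aB := xiw_bound w m.+1; have bB := phiw_bound w m.+1.
have [y0|y0] := eqVneq (xiw w m.+1 i.+1) 0; last first.
  rewrite !phiw_odd_step; try by [left; apply/eqP|right; apply/eqP].
  have b1 : phiw w m.+1 i.+1 <> 0 by move/(oo i.+1); apply/eqP.
  have b0 := alternates_next i balt; have b2 := alternates_next i.+1 balt.
  have {}b0 : phiw w m.+1 i = 0 \/ phiw w m.+1 i = - phiw w m.+1 i.+1 by lia.
  have {}b2 : phiw w m.+1 i.+2 = 0 \/ phiw w m.+1 i.+2 = - phiw w m.+1 i.+1.
    by lia.
  split=> H; exfalso.
    by move: (aB i) (aB i.+1) (aB i.+2) y0 H; clear; lia.
  by move: H; case: b0 => ->; case: b2 => ->; clear -b1; lia.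
have b1 := (oo i.+1).1 y0.
have [x0|x0] := eqVneq (xiw w m.+1 i) 0;
    have [z0|z0] := eqVneq (xiw w m.+1 i.+2) 0.
- have C0 := w00 i x0 y0; have C1 := w00 i.+1 y0 z0.
  rewrite !phiw_constant//= ?negbK//.
  by rewrite x0 y0 (constant_succ _ _ _ C0); lia.
- have C0 := w00 i x0 y0; rewrite [phiw w m.+2 i]phiw_constant//= ?negbK//.
  rewrite phiw_odd_step//; last by right; apply/eqP.
  suff -> : phiw w m.+1 i.+2 = - letter_sign (w i).
    by rewrite x0 y0 b1; case: (w i); rewrite /letter_sign; lia.
  case: m mo C0 {I balt oo gap w00 aB bB y0 x0 b1} z0 => // m mo C0 z0.
  have C2 := constant_tail _ _ _ C0; have C3 := constant_tail _ _ _ C2.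
  have w2 : w i.+2 = w i.
    by rewrite (constant_succ _ _ _ C2) (constant_succ _ _ _ C0).
  rewrite phiw_last_differs// w2//.
  (* Equal letters would make the factor constant, so that [xi] vanishes, against [z0]. *)
  case: (boolP (w (i.+2 + m.+1)%N == w i)) => [/eqP E|]; last first.
    by case: (w _); case: (w i).
  case/eqP: z0; apply: xiw_constant => t; rewrite ltnS leq_eqVlt.
  by case/orP => [/eqP ->|tm]; [rewrite E w2|apply: C3].
- have C1 := w00 i.+1 y0 z0; rewrite [phiw w m.+2 i.+1]phiw_constant//= ?negbK//.
  rewrite phiw_odd_step//; last by left; apply/eqP.
  suff -> : phiw w m.+1 i = letter_sign (w i.+1).
    by rewrite z0 y0 b1; case: (w i.+1); rewrite /letter_sign; lia.
  case: m mo C1 {I balt oo gap w00 aB bB y0 z0 b1} x0 => // m mo C1 x0.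
  have C1' := constant_init _ _ _ (constant_init _ _ _ C1).
  rewrite phiw_head_differs//.
    (* [m] now stands for the predecessor of the odd length, so the power of -1 is 1. *)
    have me : odd m = false by apply/negbTE.
    by rewrite -signr_odd me mulr1.
  case: (boolP (w i == w i.+1)) => [/eqP E|]; last first.
    by case: (w i); case: (w i.+1).
  case/eqP: x0; apply: xiw_constant => -[|t] tm; first by rewrite addn0.
  by rewrite E -addSnnS C1'.
(* Both [xi] and [phi] change sign across the middle zero: the [xi] terms cancel, and the two
   differences of [phi] coincide. *)
- have C : phiw w m.+1 i.+2 = - phiw w m.+1 i.
    apply: (alternates_next2 (g := 0)) => //.
      by move/(oo i); apply/eqP.
    by move/(oo i.+2); apply/eqP.
  have a2 : xiw w m.+1 i.+2 = - xiw w m.+1 i.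
    by apply: (alternates_next2 i (leqnn 1) gap) => //; apply/eqP.
  rewrite !phiw_odd_step; try by [left; apply/eqP|right; apply/eqP].
  rewrite a2 y0 b1 C; clear; lia.
Qed.

(** A run of [d] zeros of [xiw w m.+3] arises from [xiw w m.+1] in two ways: from a pattern s, 0, -s
    with [d = 1], where the sign change is visible, or from [d.+2] zeros, where it is inherited. *)
Lemma invariant_gap w m : odd m -> invariant w m ->
  alternates_beyond 1 (xiw w m.+3).
Proof.
move=> mo I i d d1; have gap := xiw_gap _ _ I.
have b := xiw_bound w m.+1; have E j := xiw_step2 w m j mo I.
move=> ui ut ud.
have zero t : (t < d)%N -> xiw w m.+1 (i + t).+2 = 0 /\
    xiw w m.+1 (i + t).+3 = - xiw w m.+1 (i + t).+1.
  move=> td; have := ut t td; rewrite E !addnS.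
  move: (b (i + t).+1) (b (i + t).+2) (b (i + t).+3); lia.
have := zero 0%N d1; rewrite addn0 => -[y0 z0].
have [x0|x0] := eqVneq (xiw w m.+1 i.+1) 0; last first.
  have dE : d = 1%N.
    apply/eqP; rewrite eqn_leq d1 andbT leqNgt; apply/negP => d2.
    have := zero 1%N d2; rewrite addn1; lia.
  rewrite {}dE !E addn2 y0 in ud *; move: (b i) (b i.+1) (b i.+4).
  lia.
have Z t : (t < d.+2)%N -> xiw w m.+1 (i + t.+1)%N = 0.
  have Z' s : (s < d)%N -> xiw w m.+1 (i + s).+2 = 0 by move=> /zero[].
  case: t => [|t]; rewrite ?addn1// ltnS !addnS ltnS leq_eqVlt.
  case/orP => [/eqP ->|/Z'//].
  case: d d1 zero Z' {ut ud} => // d _ zero Z'.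
  have [_] := zero d (ltnSn d); rewrite addnS => ->.
  case: d zero Z' => [|d] zero Z'; first by rewrite addn0 x0 oppr0.
  by rewrite addnS Z' ?oppr0.
have Zd := Z d.+1 (ltnSn _); have Zd' := Z d (ltnW (ltnSn _)).
have := gap i d.+2 isT; rewrite !E !addnS in ui ud Zd Zd' *.
rewrite x0 y0 Zd Zd' in ui ud *.
move=> G; move: (b i) (b (i + d).+3) ui ud.
have {}G : xiw w m.+1 i <> 0 -> xiw w m.+1 (i + d).+3 <> 0 ->
   xiw w m.+1 (i + d).+3 = - xiw w m.+1 i by move=> ? ?; apply: G.
lia.
Qed.

Lemma invariant_step w m : odd m -> invariant w m -> invariant w m.+2.
Proof.
move=> mo I; have b := xiw_bound w m.+1; have E j := xiw_step2 w m j mo I.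
split=> [i|i||i|i].
- exact: invariant_phiw_neq0.
- exact: invariant_xiw_phiw.
- exact: invariant_gap.
(* Two adjacent zeros force four zeros at length [m.+1], whose three constant factors overlap and
   glue. *)
- rewrite !E => x0 y0; move: (b i) (b i.+1) (b i.+2) (b i.+3) => b0 b1 b2 b3.
  have [a0 a1 a2 a3] : [/\ xiw w m.+1 i = 0, xiw w m.+1 i.+1 = 0,
      xiw w m.+1 i.+2 = 0 & xiw w m.+1 i.+3 = 0] by split; lia.
  have C := constant_cat w _ m.+2 isT.
  by apply: constant_cat => //; apply: C; apply: (xiw_00 _ _ I).
(* Likewise three alternating signs force five, giving three overlapping alternating factors. *)
- rewrite !E => x0 y0 z0.
  move: (b i) (b i.+1) (b i.+2) (b i.+3) (b i.+4) => b0 b1 b2 b3 b4.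
  have [a0 a1 a2 a3 a4] : [/\ xiw w m.+1 i <> 0,
      xiw w m.+1 i.+1 = - xiw w m.+1 i, xiw w m.+1 i.+2 = xiw w m.+1 i,
      xiw w m.+1 i.+3 = - xiw w m.+1 i & xiw w m.+1 i.+4 = xiw w m.+1 i].
    by split; lia.
  have A := alternating_cat w _ m.+3 isT.
  by apply: alternating_cat => //; apply: A; apply: (xiw_alt3 _ _ I);
     rewrite ?a1 ?a2 ?a3 ?a4 ?opprK//; lia.
Qed.

Lemma invariantP w m : odd m -> invariant w m.
Proof.
have [n] := ubnP m; elim: n m => // n IHn [|[|m]]// mn mo.
  exact: invariant1.
by apply: invariant_step; [move: mo => /=; rewrite negbK|apply: IHn; lia].
Qed.

(** * Sign alternation of [psi] *)

Lemma psi_factor w n i :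
  psi (factor w i (i + n)) = xiw w n i ^+ n * phiw w n i.
Proof. by rewrite /psi size_factor. Qed.

Lemma alternates_psi_even w n : ~~ odd n ->
  alternates_beyond 0 (fun i => psi (factor w i (i + n))).
Proof.
case: n => [|m] me i d _; first by rewrite psi_factor /phiw factorE mulr0.
have mo : odd m by move: me; rewrite /= negbK.
have E j : psi (factor w j (j + m.+1)) = phiw w m.+1 j.
  rewrite psi_factor; case: (eqVneq (xiw w m.+1 j) 0) => [x0|x0].
    by rewrite x0 (xiw_phiw _ _ (invariantP w m mo) j).1// mulr0.
  have x2 : xiw w m.+1 j ^+ 2 = 1.
    move: (xiw_bound w m.+1 j) x0; nia.
  rewrite -[RHS]mul1r; congr (_ * _).
  move: (xiw w m.+1 j) x2 => x x2; have -> : m.+1 = (2 * m.+1./2)%N by lia.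
  by rewrite exprM x2 expr1n.
rewrite !E => u0 ut; apply: (phiw_alternates w m mo) => //.
  exact: (phiw_neq0 _ _ (invariantP w m mo)).
by move=> t td; rewrite -E ut.
Qed.

(** A nonzero [u j] equals [- (a j * b j)] if [a j] is nonzero and [a j.+1 * b j.+1] if [a j.+1] is
    nonzero. A zero of [u] outside the gaps of [a] preserves the product, and so does a whole gap,
    across which both [a] and [b] change sign. *)
Lemma alternates_sum_diff (a b u : nat -> int) :
  (forall i, -1 <= a i <= 1) -> (forall i, -1 <= b i <= 1) ->
  (forall i, a i = 0 <-> b i = 0) ->
  alternates_beyond 1 a -> alternates_beyond 0 b ->
  (forall i, u i = Num.sg (a i + a i.+1) * Num.sg (b i.+1 - b i)) ->
  alternates_beyond 0 u.
Proof.
move=> aB bB ab0 agap balt uE.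
have val j : a j = 0 /\ b j = 0 \/
    (a j = 1 \/ a j = -1) /\ (b j = 1 \/ b j = -1).
  by move: (aB j) (bB j) (ab0 j); clear; lia.
have bS j : b j = b j.+1 -> b j = 0.
  by move: (alternates_next j balt); clear; lia.
have u_left j : a j <> 0 -> u j <> 0 -> u j = - (a j * b j).
  rewrite uE.
  by case: (val j) => [[-> ->]//|[[->|->] [->|->]]];
     case: (val j.+1) => [[-> ->]//|[[->|->] [->|->]]] .
have u_right j : a j.+1 <> 0 -> u j <> 0 -> u j = a j.+1 * b j.+1.
  rewrite uE.
  by case: (val j) => [[-> ->]|[[->|->] [->|->]]];
     case: (val j.+1) => [[-> ->]//|[[->|->] [->|->]]] .
have u_zero j : a j <> 0 -> u j = 0 ->
    a j.+1 <> 0 /\ a j.+1 * b j.+1 = a j * b j.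
  rewrite uE; move: (bS j).
  by case: (val j) => [[-> ->]//|[[->|->] [->|->]]];
     case: (val j.+1) => [[-> ->]//|[[->|->] [->|->]]] // /(_ erefl).
have u_00 j : a j = 0 -> (u j = 0 <-> a j.+1 = 0).
  rewrite uE => aj; have bj := (ab0 j).1 aj; rewrite aj bj.
  by case: (val j.+1) => [[-> ->]//|[[->|->] [->|->]]].
move=> i d _ ui ut ud.
(* Read from left to right, the products a * b keep track of the last nonzero
   value of u. *)
have track t : (t <= d)%N ->
    (a (i + t).+1 <> 0 /\ a (i + t).+1 * b (i + t).+1 = u i) \/
    exists s, [/\ (s <= t)%N, a (i + s)%N <> 0, a (i + s)%N * b (i + s)%N = - u i
      & forall r, (s < r)%N -> (r <= t.+1)%N -> a (i + r)%N = 0].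
  elim: t => [_|t IHt td].
    rewrite addn0; have [a1|/eqP a1] := eqVneq (a i.+1) 0; last first.
      by left; rewrite u_right.
    have a0 : a i <> 0 by move=> /u_00 [_ /(_ a1)].
    (* Entering a gap of [a] makes [u] nonzero, so up to the next nonzero value of [u] a gap can
       only start right after [i]. *)
    right; exists 0%N; split; rewrite ?addn0//; first by rewrite u_left ?opprK.
    by case=> [|[|r]]//; rewrite addn1.
  have ut1 : u (i + t).+1 = 0 by rewrite -addnS ut.
  rewrite addnS; case: (IHt (ltnW td)) => [[a1 ab]|[s [st as0 abs az]]].
    by left; have [? ->] := u_zero _ a1 ut1.
  right; exists s; split=> //; first exact: leqW.
  move=> r sr; rewrite leq_eqVlt => /orP[/eqP ->|]; last exact: az.
  by rewrite !addnS; apply/u_00 => //; rewrite -addnS az.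
have [[a1 ab]|[s [sd as0 abs az]]] := track d (leqnn d).
  by rewrite addnS in ud *; rewrite u_left// ab.
have a1 : a (i + d.+1)%N = 0 by apply: az.
have a2 : a (i + d).+2 <> 0.
  by rewrite addnS in a1 ud; move=> /(u_00 _ a1).
have e : (i + d).+2 = ((i + s) + (d - s).+1.+1)%N by lia.
have gap t : (t < (d - s).+1)%N -> a (i + s + t.+1)%N = 0.
  by move=> td; rewrite -addnA az//; lia.
have A : a (i + d).+2 = - a (i + s)%N.
  by rewrite e in a2 *; apply: agap.
have B : b (i + d).+2 = - b (i + s)%N.
  rewrite e in a2 *; apply: balt => //; last by move/ab0.
    by move/ab0.
  by move=> t /gap/ab0.
by rewrite addnS in ud *; rewrite u_right// A B mulrNN.
Qed.

Lemma alternates_psi_odd w n : odd n ->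
  alternates_beyond 0 (fun i => psi (factor w i (i + n))).
Proof.
case: n => [|[|m]]// => [_ i d _|mo].
  (* For [n = 1], [xi] of a single letter is 0, so [psi] vanishes everywhere. *)
  rewrite psi_factor xiw_constant ?mul0r//.
  by case=> // _; rewrite addn0.
rewrite /= negbK in mo; have I := invariantP w m mo.
apply: (@alternates_sum_diff (xiw w m.+1) (phiw w m.+1)).
- exact: xiw_bound.
- exact: phiw_bound.
- exact: (xiw_phiw _ _ I).
- exact: (xiw_gap _ _ I).
- exact: phiw_alternates mo (phiw_neq0 _ _ I).
move=> i; rewrite psi_factor.
have -> : xiw w m.+2 i ^+ m.+2 = xiw w m.+2 i.
  move: (xiw_bound w m.+2 i) => xB.
  have {xB} : [|| xiw w m.+2 i == 0, xiw w m.+2 i == 1 | xiw w m.+2 i == -1].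
    by lia.
  case/or3P => /eqP ->; rewrite ?expr0n ?expr1n//.
  by rewrite -signr_odd /= mo.
have xE : xiw w m.+2 i = Num.sg (xiw w m.+1 i + xiw w m.+1 i.+1).
  by rewrite xiw_step//; left; rewrite /= negbK.
(* Where the [xi] factor is nonzero, one of its two summands is nonzero, and [phi] follows its
   ordinary clause. *)
rewrite -xE; have [->|x0] := eqVneq (xiw w m.+2 i) 0; first by rewrite !mul0r.
rewrite phiw_odd_step//; have [a0|/eqP a0] := eqVneq (xiw w m.+1 i) 0.
  by right=> a1; case/eqP: x0; rewrite xE a0 a1.
by left.
Qed.

Lemma alternates_psi w n :
  alternates_beyond 0 (fun i => psi (factor w i (i + n))).
Proof.
by case: (boolP (odd n)); [apply: alternates_psi_odd|apply: alternates_psi_even].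
Qed.

Local Close Scope ring_scope.

Theorem theorem5p5 (k n : nat) (hk : 1 <= k) (w : nat -> bool)
  (hw : forall j : nat, j <= k ->
     (colourable (factor w j (j + n)) <-> j = 0 \/ j = k)) :
  psi (factor w 0 n) <> psi (factor w k (k + n)).
Proof.
case: k hk hw => // k _ hw.
have c0 : colourable (factor w 0 (0 + n)) by apply/hw => //; left.
have ck : colourable (factor w k.+1 (k.+1 + n)) by apply/hw => //; right.
(* [k] is now the predecessor, which counts the uncolourable positions strictly between the two
   ends. *)
have := alternates_psi w n 0 k isT c0; rewrite /= !add0n => -> //.
  by move: c0; rewrite /colourable add0n; lia.
move=> t tk; apply/eqP/negPn/negP => /eqP/(hw t.+1 (ltnW _))/=.
by case/(_ tk) => // -[E]; rewrite E ltnn in tk.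
Qed.
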